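(* Let $n\ge1$ and $d\ge 0$ be integers and let $p\in\mathbb{P}_d(\mathbb{R}^n)$. Let $d_j$ range over $0,2,\ldots,d$ if $d$ is even, and over $1,3,\ldots,d$ if $d$ is odd, and let $r_j>0$ be pairwise distinct radii, one for each $j$. Let $\Xi\subset\mathbb{R}^n$ be a collection of points such that, for every $j$, the set $\Xi_j:=S_{r_j}^{n-1}\cap\Xi$ is unisolvent for $\mathbb{P}_{d_j}(S_{r_j}^{n-1})$. If $$\int_{B^n(\xi,r_j)} p(x_1,\ldots,x_n)\,\mathrm{d}x_1\cdots\mathrm{d}x_n=0\qquad\text{for every } j \text{ and every } \xi\in\Xi_j,$$ then $p=0$.
   Context: $\mathbb{P}_d(\mathbb{R}^n)$ denotes the space of real polynomials in $n$ variables of total degree at most $d$. For $r>0$, $S_r^{n-1}=\{(x_1,\ldots,x_n)\in\mathbb{R}^n : \sum_{i=1}^n x_i^2=r^2\}$ is the sphere of radius $r$ centred at the origin (an orbit of $SO(n)$), and $\mathbb{P}_d(S_r^{n-1})$ is the space of restrictions to $S_r^{n-1}$ of polynomials in $\mathbb{P}_d(\mathbb{R}^n)$. A finite set of points of $S_r^{n-1}$ is unisolvent for $\mathbb{P}_d(S_r^{n-1})$ if its cardinality equals $\dim\mathbb{P}_d(S_r^{n-1})$ and the only element of $\mathbb{P}_d(S_r^{n-1})$ vanishing at all its points is $0$. For $\mathbf{c}\in\mathbb{R}^n$ and $r>0$, $B^n(\mathbf{c},r)=\{\mathbf{x}\in\mathbb{R}^n : \|\mathbf{x}-\mathbf{c}\|_2\le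 r\}$ is the closed Euclidean ball. *)

(* Defs.v *)
From HB Require Import structures.
From mathcomp Require Import all_boot all_order all_algebra.
(* The notations of mpoly clash with those of mathcomp-analysis. *)
From mathcomp Require Import -(notations) mpoly.
From mathcomp Require Import all_classical all_reals all_analysis.

Set Implicit Arguments.
Unset Strict Implicit.
Unset Printing Implicit Defensive.

Import Order.TTheory GRing.Theory Num.Theory.
Import numFieldNormedType.Exports.

Local Open Scope classical_set_scope.
Local Open Scope ring_scope.

(* Points of R^n are n-tuples, because it is on this type that the library
   provides the product sigma-algebra. *)
Notation euclidean R n := (n.-tuple (measurableTypeR R)).

Section lebesgue_measure_tuple.
Context (R : realType).

Definition cons_pair n (z : measurableTypeR R * euclidean R n) :
  euclidean R n.+1 := [tuple of z.1 :: z.2].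

Definition uncons_tuple n (x : euclidean R n.+1) :
  measurableTypeR R * euclidean R n := (thead x, [tuple of behead x]).

Lemma uncons_tupleK n : cancel (@uncons_tuple n) (@cons_pair n).
Proof. by move=> x; rewrite /cons_pair/= -tuple_eta. Qed.

Lemma cons_pairK n : cancel (@cons_pair n) (@uncons_tuple n).
Proof. by case=> a t; congr (_, _); apply/val_inj. Qed.

Lemma measurable_cons_pair n : measurable_fun [set: _] (@cons_pair n).
Proof. exact: measurable_cons. Qed.

Lemma measurable_uncons_tuple n : measurable_fun [set: _] (@uncons_tuple n).
Proof.
apply/measurable_fun_pairP; split.
- exact: (measurable_tnth (ord0 : 'I_n.+1)).
- exact: measurable_behead.
Qed.

Section cons_measure.
Context n (m : {sigma_finite_measure set (euclidean R n) -> \bar R}).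

Definition cons_measure : set (euclidean R n.+1) -> \bar R :=
  pushforward (@lebesgue_measure R \x m)%E (@cons_pair n).

Let cons_measure0 : cons_measure set0 = 0%E.
Proof. by rewrite /cons_measure /pushforward preimage_set0 measure0. Qed.

Let cons_measure_ge0 A : (0 <= cons_measure A)%E.
Proof. by rewrite /cons_measure /pushforward; apply: integral_ge0. Qed.

Let cons_measure_sigma_additive : semi_sigma_additive cons_measure.
Proof.
rewrite /cons_measure; apply: measure_semi_sigma_additive.
exact: measurable_cons_pair.
Qed.

HB.instance Definition _ := isMeasure.Build _ _ _ cons_measure
  cons_measure0 cons_measure_ge0 cons_measure_sigma_additive.

Let cons_measure_sigma_finite : sigma_finite setT cons_measure.
Proof.
have /sigma_finiteP[F [TF ndF Foo]] := sigma_finiteT (@lebesgue_measure R).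
have /sigma_finiteP[G [TG ndG Goo]] := sigma_finiteT m.
have FGT : \bigcup_k (F k `*` G k) = setT.
  apply/seteqP; split=> // -[a t] _.
  have [i _ Fa] : (\bigcup_k F k) a by rewrite -TF.
  have [j _ Gt] : (\bigcup_k G k) t by rewrite -TG.
  exists (maxn i j) => //; split => /=.
  - by move: a Fa; exact/subsetPset/ndF/leq_maxl.
  - by move: t Gt; exact/subsetPset/ndG/leq_maxr.
exists (fun k => @uncons_tuple n @^-1` (F k `*` G k)).
  by rewrite -preimage_bigcup FGT preimage_setT.
move=> k; have [mFk Fkoo] := Foo k; have [mGk Gkoo] := Goo k; split.
  rewrite -[X in measurable X]setTI.
  by apply: measurable_uncons_tuple => //; exact: measurableX.
rewrite /cons_measure /pushforward -comp_preimage.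
rewrite (_ : _ \o _ = id); last by apply/funext => z; exact: cons_pairK.
by rewrite preimage_id product_measure1E// lte_mul_pinfty// ge0_fin_numE.
Qed.

HB.instance Definition _ :=
  Measure_isSigmaFinite.Build _ _ _ cons_measure cons_measure_sigma_finite.

End cons_measure.

(* n-dimensional Lebesgue measure: the n-fold product of lebesgue_measure,
   transported along R * R^n = R^n.+1. *)
Fixpoint lebesgue_measure_tuple n :
    {sigma_finite_measure set (euclidean R n) -> \bar R} :=
  match n with
  | 0 => \d_([tuple] : euclidean R 0)
  | n'.+1 => cons_measure (lebesgue_measure_tuple n')
  end.

Lemma lebesgue_measure_tuple_box n (A : 'I_n -> set (measurableTypeR R)) :
  (forall i, measurable (A i)) ->
  lebesgue_measure_tuple n [set x | forall i, A i (tnth x i)] =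
  (\prod_(i < n) lebesgue_measure (A i))%E.
Proof.
elim: n A => [|n IHn] A mA.
  rewrite big_ord0 /= diracE mem_set//= => -[].
  by [].
rewrite big_ord_recl -IHn; last by move=> i; exact: mA.
rewrite /= /cons_measure /pushforward -product_measure1E//; last first.
  rewrite (_ : mkset _ = \bigcap_(i in [set: 'I_n])
      ((fun x : euclidean R n => tnth x i) @^-1` A (lift ord0 i))).
    apply: fin_bigcap_measurable; first exact: finite_finset.
    move=> i _; rewrite -[X in measurable X]setTI.
    exact: (measurable_tnth i).
  by apply/seteqP; split=> x /= Ax i; [move=> _|]; exact: Ax.
congr product_measure1; apply/seteqP; split=> -[a t] /=.
  move=> At; split; first exact: (At ord0).
  by move=> i; have := At (lift ord0 i); rewrite tnthS.
move=> [Aa At] i; case: (unliftP ord0 i) => [j|] ->; last exact: Aa.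
by rewrite tnthS; exact: At.
Qed.

End lebesgue_measure_tuple.

Section sphere_polynomials.
Context (R : realType) (n : nat).

Definition sphere (r : R) : set (euclidean R n) :=
  [set x | \sum_(i < n) tnth x i ^+ 2 = r ^+ 2].

Definition euclidean_ball (c : euclidean R n) (r : R) : set (euclidean R n) :=
  [set x | Num.sqrt (\sum_(i < n) (tnth x i - tnth c i) ^+ 2) <= r].

(* Restrictions to the sphere are functions on the subtype associated with it;
   msize is the total degree plus one, and 0 for the zero polynomial. *)
Definition sphere_poly (d : nat) (r : R) : set (sphere r -> R) :=
  [set f | exists2 q : mpoly n R, (msize q <= d.+1)%N &
           f = fun x : sphere r => meval (tnth (set_val x)) q].

End sphere_polynomials.
Arguments sphere {R} n r.
Arguments sphere_poly {R} n d r.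

(* W, a subspace of the possibly infinite-dimensional space V, has a basis of
   m vectors. *)
Definition has_dim (K : fieldType) (V : lmodType K) (W : set V) (m : nat) :=
  exists b : 'I_m -> V,
    [/\ forall i, W (b i),
        forall c : 'I_m -> K, \sum_(i < m) c i *: b i = 0 -> forall i, c i = 0
      & forall w, W w -> exists c : 'I_m -> K, w = \sum_(i < m) c i *: b i].

Definition unisolvent (R : realType) (n d : nat) (r : R)
    (X : set (euclidean R n)) :=
  [/\ X `<=` sphere n r,
      exists2 m, @has_dim R _ (sphere_poly n d r) m & (X #= `I_m)%card
    & forall f, sphere_poly n d r f ->
        (forall x : sphere n r, X (set_val x) -> f x = 0) -> f = 0].

(* Main.v *)
Require Import Defs.
From HB Require Import structures.
From mathcomp Require Import all_boot all_order all_algebra.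
From mathcomp Require Import -(notations) ssrcomplements mpoly.
From mathcomp Require Import all_classical all_reals all_analysis.
From mathcomp Require Import measurable_realfun zify ring lra.

(** If |c| = r, Pizzetti's formula gives for the integral of p over B(c,r) the
    value vol(B(0,1)) r^n (Ap)(c), where A = sum_k g_k |x|^(2k) Laplacian^k has
    coefficients g_k > 0 that do not depend on r and does not raise degrees.
    Multiplication by |x|^2 is adjoint to the Laplacian for the Fischer inner
    product, so <Ap, p> = sum_k g_k |Laplacian^k p|^2 >= g_0 |p|^2 and A is
    injective.  It remains to see that u = Ap, of degree at most d, is zero when
    it vanishes at all the points.  Unisolvence makes u vanish on the sphere with
    d_j = d, of radius r say, so |x|^2 - r^2 divides u, and the quotient, of
    degree at most d - 2, vanishes at the points of the other spheres: induct on
    d. *)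

Set Implicit Arguments.
Unset Strict Implicit.
Unset Printing Implicit Defensive.

Import Order.TTheory GRing.Theory Num.Theory.
Import numFieldNormedType.Exports.

Local Open Scope classical_set_scope.
Local Open Scope ring_scope.

(** * Polynomial functions and the Fischer inner product *)

Section PolynomialFunctions.
Context (n : nat) (R : numFieldType).
Implicit Types (p q u : mpoly n R) (x : 'I_n -> R).

(** In characteristic zero the naturals below [size f] are pairwise distinct, which gives one root
    more than a nonzero [f] can have. *)
Lemma poly_fun0 (f : {poly R}) : (forall t, f.[t] = 0) -> f = 0.
Proof.
move=> f0; apply/eqP/negPn/negP => /max_poly_roots.
move=> /(_ [seq i%:R | i <- iota 0 (size f)]).
rewrite size_map size_iota ltnn => H.
suff : false by [].
apply: H; first by apply/allP => t _; rewrite /root f0.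
by rewrite map_inj_uniq ?iota_uniq// => i j /eqP; rewrite eqr_nat => /eqP.
Qed.

(** The restriction of a polynomial to the line through [x] in direction [i], as a univariate
    polynomial. It reduces partial derivatives to formal derivatives in one variable. *)
Local Notation line i x :=
  (mmap polyC (fun j => (x j)%:P + (i == j)%:R *: 'X)).

Lemma deriv_line i x p : deriv (line i x p) = line i x (mderiv i p).
Proof.
pose P q := deriv (line i x q) = line i x (mderiv i q).
have PM q1 q2 : P q1 -> P q2 -> P (q1 * q2).
  by rewrite /P => P1 P2; rewrite mderivM rmorphD !rmorphM derivM P1 P2.
have P1 : P 1 by rewrite /P -mpolyC1 mderivC raddf0 mmapC derivC.
elim/mpolyind : p => [|c m p mp c0 IH].
  by rewrite mderiv0 !raddf0.
rewrite mderivD !raddfD /= IH; congr (_ + _).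
rewrite mderivZ !mmapZ mul_polyC derivZ -mul_polyC; congr (_ * _).
rewrite mpolyXE_id; apply: (big_ind P) => // j _.
elim: (m j) => [|k IHk]; first by rewrite expr0.
rewrite exprS; apply: PM IHk.
rewrite /P mmapX mmap1U mderivX mnm1E.
rewrite mmapZ derivD derivC derivZ derivX add0r eq_sym.
case: eqP => [->|_]; last by rewrite mul0r scale0r.
by rewrite -{1}[mnm1 i]add0m addmK mpolyX0 !rmorph1 mulr1 scale1r.
Qed.

Lemma horner_line i x p t :
  (line i x p).[t] = meval (fun j => x j + (i == j)%:R * t) p.
Proof.
rewrite mevalE /mmap horner_sum; apply: eq_bigr => m _.
rewrite hornerM hornerC /mmap1 horner_prod; congr (_ * _).
by apply: eq_bigr => j _; rewrite horner_exp hornerD hornerC hornerZ hornerX.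
Qed.

Lemma meval0E p : meval (fun=> 0) p = mcoeff mnm0 p.
Proof.
elim/mpolyind : p => [|c m p _ _ IH]; first by rewrite meval0 mcoeff0.
rewrite mevalD mevalZ mcoeffD mcoeffZ IH mevalX mcoeffX.
congr (_ * _ + _); case: eqP => [->|/eqP m0].
  by rewrite big1// => i _; rewrite mnm0E expr0.
have [i mi] : exists i, m i != 0%N.
  apply/existsP; apply: contraNT m0; rewrite negb_exists => /forallP m0.
  by apply/eqP/mnmP => i; rewrite mnm0E; apply/eqP/negPn.
by rewrite (bigD1 i)//= expr0n (negbTE mi) mul0r.
Qed.

(** Vanishing everywhere passes to partial derivatives, by restriction to lines. The value at 0 of
    the derivative of order [m] is the coefficient of [m] times a product of factorials, so every
    coefficient is zero. *)
Lemma mpoly_fun0 p : (forall x, meval x p = 0) -> p = 0.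
Proof.
move=> p0.
have D i q : (forall x, meval x q = 0) -> forall x, meval x (mderiv i q) = 0.
  move=> q0 x; have : line i x q = 0.
    by apply: poly_fun0 => t; rewrite horner_line.
  move/(congr1 (fun f => (deriv f).[0])).
  rewrite deriv_line horner_line deriv0 horner0 => <-.
  by apply: meval_eq => j; rewrite mulr0 addr0.
have Dm m : meval (fun=> 0) (mderivm m p) = 0.
  rewrite mderivm_foldr /=.
  suff H x : meval x (foldr (@mderiv n R) p
    (flatten [seq nseq (m i) i | i <- enum 'I_n])) = 0 by exact: H.
  by elim: (flatten _) x => [|i s IHs] x //=; exact: D.
apply/mpolyP => m; rewrite mcoeff0.
have := Dm m; rewrite meval0E mcoeff_mderivm addm0 => /eqP.
rewrite -mulr_natr mulf_eq0 => /orP[/eqP//|]; 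
rewrite pnatr_eq0 -[_ == 0%N]negbK -lt0n prodn_gt0// => i.
by rewrite ffactnn fact_gt0.
Qed.

End PolynomialFunctions.

(** * The Fischer inner product and Pizzetti's operator *)

Section Fischer.
Context (n : nat) (R : realFieldType).
Implicit Types (p q u : mpoly n R).

Definition laplacian p := \sum_i mderiv i (mderiv i p).

Definition normsq : mpoly n R := \sum_i mpolyX R (mnm1 i) ^+ 2.

(** This is the value at 0 of p(D)q, where p(D) is the differential operator obtained by replacing
    each variable with the partial derivative along it. *)
Definition fischer p q :=
  \sum_(m <- msupp p) mcoeff m p * mcoeff mnm0 (mderivm m q).

(** A common index set for several polynomials makes linearity in [p] a coefficientwise matter. *)
Lemma fischerE k p q : (msize p <= k)%N ->
  fischer p q =
  \sum_(m : bmultinom n k) mcoeff m p * mcoeff mnm0 (mderivm m q).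
Proof.
move=> le_pk; set I : subFinType _ := bmultinom n k.
rewrite /fischer (big_mksub I) ?msupp_uniq //=; last first.
  by move=> x /msize_mdeg_lt /leq_trans; apply.
by rewrite big_rmcond //= => j /memN_msupp_eq0 ->; rewrite mul0r.
Qed.

Lemma fischerDl p1 p2 q : fischer (p1 + p2) q = fischer p1 q + fischer p2 q.
Proof.
pose k := maxn (msize p1) (msize p2).
rewrite !(@fischerE k) ?leq_maxl ?leq_maxr ?msizeD_le//.
by rewrite -big_split; apply: eq_bigr => m _; rewrite mcoeffD mulrDl.
Qed.

Lemma fischerZl c p q : fischer (c *: p) q = c * fischer p q.
Proof.
rewrite !(@fischerE (msize p)) ?msizeZ_le// big_distrr.
by apply: eq_bigr => m _; rewrite mcoeffZ -mulrA.
Qed.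

Lemma fischer0l q : fischer 0 q = 0.
Proof. by rewrite /fischer msupp0 big_nil. Qed.

Lemma fischer_suml I (r : seq I) (F : I -> mpoly n R) q :
  fischer (\sum_(i <- r) F i) q = \sum_(i <- r) fischer (F i) q.
Proof.
apply: (big_morph (fischer^~ q) _ (fischer0l q)) => p1 p2; exact: fischerDl.
Qed.

Lemma fischer_sumr I (r : seq I) (F : I -> mpoly n R) p :
  fischer p (\sum_(i <- r) F i) = \sum_(i <- r) fischer p (F i).
Proof.
rewrite /fischer exchange_big; apply: eq_bigr => m _.
by rewrite !raddf_sum mulr_sumr.
Qed.

Lemma fischer_mulX i p q :
  fischer (mpolyX R (mnm1 i) * p) q = fischer p (mderiv i q).
Proof.
elim/mpolyind : p => [|c m p _ _ IH]; first by rewrite mulr0 !fischer0l.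
rewrite mulrDr !fischerDl -scalerAr !fischerZl IH -mpolyXD; congr (_ * _ + _).
rewrite /fischer !msuppX !big_seq1 !mcoeffX !eqxx !mul1r.
by rewrite mderivmDm mderivmU1m.
Qed.

Lemma fischer_normsq p q : fischer (normsq * p) q = fischer p (laplacian q).
Proof.
rewrite mulr_suml fischer_suml fischer_sumr; apply: eq_bigr => i _.
by rewrite -mulrA !fischer_mulX.
Qed.

Lemma fischer_normsqX k p q :
  fischer (normsq ^+ k * p) q = fischer p (iter k laplacian q).
Proof.
elim: k p => [|k IH] p; first by rewrite mul1r.
by rewrite exprSr -mulrA IH fischer_normsq.
Qed.

(** The form is diagonal on monomials, with positive weights; definiteness follows. *)
Lemma fischer_term m p :
  mcoeff m p * mcoeff mnm0 (mderivm m p) =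
  mcoeff m p ^+ 2 * (\prod_(i < n) (m i)`!)%:R.
Proof.
rewrite mcoeff_mderivm addm0 expr2 mulr_natr mulrnAr; congr (_ *+ _).
by apply: eq_bigr => i _; rewrite ffactnn.
Qed.

Lemma fischer_ge0 p : 0 <= fischer p p.
Proof.
by apply: sumr_ge0 => m _; rewrite fischer_term mulr_ge0 ?sqr_ge0.
Qed.

Lemma fischer_eq0 p : fischer p p = 0 -> p = 0.
Proof.
move=> /eqP; rewrite /fischer big_seq psumr_eq0 => [|m _]; last first.
  by rewrite fischer_term mulr_ge0 ?sqr_ge0.
move=> /allP p0; apply/mpolyP => m; rewrite mcoeff0.
apply/eqP; rewrite mcoeff_eq0; apply/negP => mp.
have := p0 _ mp; rewrite mp fischer_term mulf_eq0 sqrf_eq0 mcoeff_eq0 mp/=.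
rewrite pnatr_eq0 -[_ == 0%N]negbK -lt0n prodn_gt0// => i.
by rewrite fact_gt0.
Qed.

(** The operator A, truncated to [k] terms. Nothing is lost once [k.*2] is at least [msize p], since
    the further iterated Laplacians vanish. *)
Definition pizzetti (k : nat) (g : nat -> R) p :=
  \sum_(i < k) g i *: (normsq ^+ i * iter i laplacian p).

(** Pairing with [p] gives a sum of nonnegative terms, so each of them is zero. The term of index 0,
    present because there are [k.+1] terms, is a positive multiple of [fischer p p]. *)
Lemma pizzetti_inj k g p : (forall i, 0 < g i) ->
  pizzetti k.+1 g p = 0 -> p = 0.
Proof.
move=> g0 p0; apply: fischer_eq0; apply/eqP.
have /eqP : fischer (pizzetti k.+1 g p) p = 0 by rewrite p0 fischer0l.
have ge i : 0 <= fischer (g i *: (normsq ^+ i * iter i laplacian p)) p.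
  by rewrite fischerZl fischer_normsqX mulr_ge0 ?fischer_ge0 ?ltW.
rewrite fischer_suml psumr_eq0// => /allP /(_ ord0).
rewrite mem_index_enum => /(_ isT) /=.
by rewrite fischerZl mul1r mulf_eq0 gt_eqF.
Qed.

(** * Degree bounds *)

Lemma msize_mderiv i p : (msize (mderiv i p) <= (msize p).-1)%N.
Proof.
rewrite [leqLHS]msizeE; apply/bigmax_leqP_seq => m; rewrite mcoeff_msupp.
rewrite mcoeff_mderiv -mulr_natr mulf_eq0 => /norP[+ _] _.
rewrite -mcoeff_msupp => /msize_mdeg_lt; rewrite mdegD mdeg1 addn1.
by case: (msize p).
Qed.

Lemma msize_laplacian p : (msize (laplacian p) <= msize p - 2)%N.
Proof.
rewrite (leq_trans (msize_sum _ _ _))//; apply/bigmax_leqP => i _.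
rewrite (leq_trans (msize_mderiv _ _))// subn2 -!subn1 leq_sub2r//.
by rewrite subn1 msize_mderiv.
Qed.

Lemma msize_iter_laplacian k p :
  (msize (iter k laplacian p) <= msize p - k.*2)%N.
Proof.
elim: k => [|k IH]; first by rewrite subn0.
by rewrite iterS; have := msize_laplacian (iter k laplacian p); lia.
Qed.

Lemma msize_normsqM p : (msize (normsq * p) <= (msize p).+2)%N.
Proof.
rewrite mulr_suml (leq_trans (msize_sum _ _ _))//; apply/bigmax_leqP => i _.
have [->|p0] := eqVneq p 0; first by rewrite mulr0 msize0.
have X0 m : mpolyX R m != 0 :> mpoly n R by rewrite -msize_poly_eq0 msizeX.
by rewrite expr2 -mpolyXD msizeM// msizeX mdegD mdeg1.
Qed.

Lemma msize_normsqXM k p : (msize (normsq ^+ k * p) <= msize p + k.*2)%N.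
Proof.
elim: k => [|k IH]; first by rewrite mul1r addn0.
by rewrite exprS -mulrA (leq_trans (msize_normsqM _))// doubleS !addnS !ltnS.
Qed.

Lemma msize_pizzetti k g p : (msize (pizzetti k g p) <= msize p)%N.
Proof.
rewrite (leq_trans (msize_sum _ _ _))//; apply/bigmax_leqP => i _.
rewrite (leq_trans (msizeZ_le _ _))//.
(* When the iterated Laplacian is nonzero, the truncated subtraction in its degree bound is a true
   one, and |x|^(2i) gives back at most the degree that was lost. *)
have [->|D0] := eqVneq (iter i laplacian p) 0; first by rewrite mulr0 msize0.
rewrite (leq_trans (msize_normsqXM _ _))//.
move: D0; rewrite -msize_poly_eq0 => D0.
by have := msize_iter_laplacian i p; lia.
Qed.

End Fischer.

(** * Polynomials vanishing on spheres *)

Section SphereIdeal.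
Context (n : nat) (R : rcfType).
Implicit Types (p q u v : mpoly n R) (x : 'I_n -> R) (r : R).

Local Notation N := (normsq n R).

(** Homogeneity is stated on values, to be applied with t = -1 and with rescalings onto a sphere. *)
Definition homogeneous_fun k p :=
  forall t x, meval (fun i => t * x i) p = t ^+ k * meval x p.

Lemma mevalXn x p k : meval x (p ^+ k) = meval x p ^+ k.
Proof. exact: rmorphXn. Qed.

Lemma meval_normsq x : meval x N = \sum_i x i ^+ 2.
Proof.
rewrite /normsq raddf_sum; apply: eq_bigr => i _.
by rewrite /= expr2 mevalM mevalXU.
Qed.

Lemma homogeneous_fun_monomial m i c :
  homogeneous_fun (mdeg m + i.*2) (c *: (mpolyX R m * N ^+ i)).
Proof.
move=> t x; rewrite !mevalZ !mevalM !mevalX !mevalXn !meval_normsq.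
under [in LHS]eq_bigr do rewrite exprMn.
under [X in X ^+ i]eq_bigr do rewrite exprMn.
rewrite big_split -mulr_sumr exprMn /=.
rewrite -exprM mul2n exprD.
have -> : \prod_(j < n) t ^+ m j = t ^+ mdeg m by rewrite prodrXr mdegE.
ring.
Qed.

Lemma homogeneous_funD k p q : homogeneous_fun k p -> homogeneous_fun k q ->
  homogeneous_fun k (p + q).
Proof. by move=> hp hq t x; rewrite !mevalD hp hq mulrDr. Qed.

Lemma homogeneous_fun0 k : homogeneous_fun k 0.
Proof. by move=> t x; rewrite !meval0 mulr0. Qed.

(* Multiplying monomials by powers of |x|^2/r^2, which is 1 on the sphere, makes
   all degrees of the same parity equal. *)
Lemma homogenize_mod_sphere r D u : r != 0 -> (msize u <= D.*2.+1)%N ->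
  exists a b v, [/\ u = a + b + (N - mpolyC n (r ^+ 2)) * v,
    homogeneous_fun D.*2 a & homogeneous_fun D.*2.+1 b].
Proof.
move=> r0 uD; set S := N - _.
have SE : S = r ^+ 2 *: ((r ^+ 2)^-1 *: N - 1).
  rewrite scalerBr scalerA mulfV ?expf_neq0// scale1r.
  by rewrite -mul_mpolyC mulr1.
rewrite [u]mpolyE big_seq; elim/big_ind : _ => [|p q|m mu].
- exists 0, 0, 0; rewrite mulr0 !addr0; split => //; exact: homogeneous_fun0.
- move=> [a [b [v [-> ha hb]]]] [a' [b' [v' [-> ha' hb']]]].
  exists (a + a'), (b + b'), (v + v'); split; [|exact: homogeneous_funD..].
  ring.
have mD : (mdeg m <= D.*2)%N.
  by have := msize_mdeg_lt mu; move/leq_trans/(_ uD); rewrite ltnS.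
pose w : mpoly n R := (r ^+ 2)^-1 *: N; set c := mcoeff m u.
(* The cofactor comes from the geometric sum: 1 - w^i is -(w - 1) times the sum of the w^j for j <
   i, and S = r^2 (w - 1). *)
have E i : exists v, c *: mpolyX R m =
    (c * (r ^+ 2) ^- i) *: (mpolyX R m * N ^+ i) + S * v.
  exists (- (c * (r ^+ 2)^-1) *: (mpolyX R m * \sum_(j < i) w ^+ j)).
  rewrite SE -/w -scalerAr -scalerAl scalerA mulNr mulfVK ?expf_neq0//.
  rewrite mulrCA -subrX1 [w ^+ i]exprZn mulrBr mulr1 -scalerAr scalerBr.
  rewrite !scaleNr scalerA exprVn opprK.
  by rewrite addrA subrr add0r.
(* This exponent brings the degree to [D.*2] when [mdeg m] is even and to [D.*2.+1] when it is
   odd. *)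
set i := (D - (mdeg m)./2)%N; have [v ->] := E i.
set a := _ *: (_ * _); have ha k : k = (mdeg m + i.*2)%N -> homogeneous_fun k a.
  by move=> ->; exact: homogeneous_fun_monomial.
have [em|om] := boolP (odd (mdeg m)); [exists 0, a, v|exists a, 0, v].
  by rewrite add0r; split=> //; [exact: homogeneous_fun0|apply: ha; lia].
by rewrite addr0; split=> //; [apply: ha; lia|exact: homogeneous_fun0].
Qed.

(** The square of the first variable occurs with coefficient 1. *)
Lemma msize_normsq_sub c : (0 < n)%N -> (2 < msize (N - mpolyC n c))%N.
Proof.
move=> n0; pose i0 := Ordinal n0; pose m := mnm_add (mnm1 i0) (mnm1 i0).
have <- : mdeg m = 2%N by rewrite mdegD !mdeg1.
apply: msize_mdeg_lt; rewrite mcoeff_msupp mcoeffB mcoeffC.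
have -> : (m == mnm0) = false.
  by apply/eqP => /(congr1 (@mdeg _)); rewrite mdegD !mdeg1 mdeg0.
rewrite mulr0 subr0 raddf_sum /= (bigD1 i0)//= big1 => [|i ii0]; last first.
  rewrite expr2 -mpolyXD mcoeffX; case: eqP => // /mnmP /(_ i0).
  by rewrite !mnmDE !mnm1E (negbTE ii0) eqxx.
by rewrite expr2 -mpolyXD mcoeffX eqxx addr0 oner_neq0.
Qed.

(** Every nonzero point can be rescaled onto the sphere, so [p] vanishes away from the origin. The
    factor [N] covers the origin: [N * p] vanishes everywhere, and [N] is not zero. *)
Lemma homogeneous_fun_eq0 k r p : (0 < n)%N -> 0 < r -> homogeneous_fun k p ->
  (forall x, \sum_i x i ^+ 2 = r ^+ 2 -> meval x p = 0) -> p = 0.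
Proof.
move=> n0 r0 hp p0.
have N0 : N != 0.
  have := msize_normsq_sub 0 n0; rewrite mpolyC0 subr0 -msize_poly_eq0.
  by case: (msize _).
have : N * p = 0.
  apply: mpoly_fun0 => x; rewrite mevalM meval_normsq.
  set s := \sum_i _.
  have s0 : 0 <= s by apply: sumr_ge0 => i _; exact: sqr_ge0.
  have [->|sN0] := eqVneq s 0; first by rewrite mul0r.
  have q0 : 0 < Num.sqrt s by rewrite sqrtr_gt0 lt_neqAle eq_sym sN0.
  have := p0 (fun i => r / Num.sqrt s * x i).
  rewrite hp.
  under eq_bigr do rewrite exprMn.
  rewrite -mulr_sumr -/s expr_div_n sqr_sqrtr// divfK// => /(_ erefl) /eqP.
  rewrite mulf_eq0 expf_eq0 gt_eqF ?divr_gt0// andbF => /eqP ->.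
  by rewrite mulr0.
by move=> /eqP; rewrite mulf_eq0 (negbTE N0) => /eqP.
Qed.

(** Modulo |x|^2 - r^2, [u] is a + b with a homogeneous of even degree and b of odd degree.
    Comparing the values at x and -x shows that both vanish on the sphere, hence identically. *)
Lemma vanish_on_sphere r u : (0 < n)%N -> 0 < r ->
  (forall x, \sum_i x i ^+ 2 = r ^+ 2 -> meval x u = 0) ->
  exists2 v, u = (N - mpolyC n (r ^+ 2)) * v & (msize v <= msize u - 2)%N.
Proof.
move=> n0 r0 u0.
have [|a [b [v [uE ha hb]]]] :=
  @homogenize_mod_sphere r (msize u) u (lt0r_neq0 r0); first by lia.
have ab x : \sum_i x i ^+ 2 = r ^+ 2 -> meval x a + meval x b = 0.
  move=> xr; have := u0 x xr.
  by rewrite uE !mevalD mevalM mevalB meval_normsq mevalC xr subrr mul0r addr0.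
have ab' x : \sum_i x i ^+ 2 = r ^+ 2 -> meval x a - meval x b = 0.
  move=> xr; have := ab (fun i => -1 * x i).
  rewrite ha hb [(-1) ^+ _.+1]exprS -signr_odd odd_double expr0.
  rewrite mul1r mulr1 mulN1r; apply.
  by rewrite -xr; apply: eq_bigr => i _; rewrite mulN1r sqrrN.
have {ha} a0 : a = 0.
  apply: (homogeneous_fun_eq0 n0 r0 ha) => x xr.
  by have := ab x xr; have := ab' x xr; lra.
have {hb} b0 : b = 0.
  apply: (homogeneous_fun_eq0 n0 r0 hb) => x xr.
  by have := ab x xr; rewrite a0 meval0 add0r.
exists v; first by rewrite uE a0 b0 !add0r.
have [->|v0] := eqVneq v 0; first by rewrite msize0.
have S3 := msize_normsq_sub (r ^+ 2) n0.
rewrite uE a0 b0 !add0r msizeM//.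
  by move: S3; set s := mmeasure _ (_ - _); set t := mmeasure _ _; lia.
by apply: contraTneq S3 => ->; rewrite msize0.
Qed.

(** Induction on the number of spheres, removing the one of largest index, hence of largest degree.
    Here [e] is the common parity of the degrees [e + j.*2], and the hypothesis on [q] is the
    uniqueness that unisolvence of [X j] provides. *)
Lemma vanish_on_spheres_eq0 (k e : nat) (r : nat -> R)
    (X : nat -> ('I_n -> R) -> Prop) u :
  (0 < n)%N -> (e < 2)%N -> (forall j, (j <= k)%N -> 0 < r j) ->
  (forall i j, (i <= k)%N -> (j <= k)%N -> r i = r j -> i = j) ->
  (forall j x, (j <= k)%N -> X j x -> \sum_i x i ^+ 2 = r j ^+ 2) ->
  (forall j q, (j <= k)%N -> (msize q <= (e + j.*2).+1)%N ->
    (forall x, X j x -> meval x q = 0) ->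
    forall x, \sum_i x i ^+ 2 = r j ^+ 2 -> meval x q = 0) ->
  (msize u <= (e + k.*2).+1)%N ->
  (forall j x, (j <= k)%N -> X j x -> meval x u = 0) ->
  u = 0.
Proof.
move=> n0 e2; elim: k u => [|k IH] u r0 rinj XS uni us u0.
  have [v uE vs] := vanish_on_sphere n0 (r0 _ (leqnn _))
    (uni _ u (leqnn _) us (fun x => u0 _ x (leqnn _))).
  rewrite uE; suff -> : v = 0 by rewrite mulr0.
  (* With a single sphere [u] has degree at most 1, which leaves no room for a nonzero quotient. *)
  apply/eqP; rewrite -msize_poly_eq0 -leqn0 (leq_trans vs)// leq_subLR addn0.
  by apply: (leq_trans us); rewrite addn0; apply: e2.
have [v uE vs] := vanish_on_sphere n0 (r0 _ (leqnn _))
    (uni _ u (leqnn _) us (fun x => u0 _ x (leqnn _))).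
rewrite uE (IH v) ?mulr0//.
- by move=> j jk; apply: r0; lia.
- by move=> i j ik jk; apply: rinj; lia.
- by move=> j x jk; apply: XS; lia.
- by move=> j q jk; apply: uni; lia.
- by apply: (leq_trans vs); rewrite leq_subLR; apply: (leq_trans us); lia.
(* At a point of sphere [j] the divisor takes the value r_j^2 - r_(k+1)^2, nonzero since the radii
   are positive and distinct. So the quotient vanishes there. *)
move=> j x jk Xx; have /eqP := u0 j x (leqW jk) Xx.
rewrite uE mevalM mevalB mevalC meval_normsq (XS j)//; last by lia.
rewrite mulf_eq0 subr_eq0 => /orP[|/eqP//].
rewrite eqrXn2 ?ltW ?r0//; last by lia.
move=> /eqP rjk; have jE : j = k.+1 by apply: rinj => //; lia.
by move: jk; rewrite jE ltnn.
Qed.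

End SphereIdeal.

(** * Pizzetti's formula *)

(* The a-th moment of the standard normal law: (a-1)!! for even a, else 0. *)
Fixpoint normal_moment (a : nat) : nat :=
  match a with
  | 0 => 1
  | 1 => 0
  | a'.+2 => a'.+1 * normal_moment a'
  end.

Lemma normal_moment_odd a : odd a -> normal_moment a = 0%N.
Proof.
suff H : (odd a -> normal_moment a = 0%N) /\
         (odd a.+1 -> normal_moment a.+1 = 0%N) by case: H.
elim: a => //= a [IH1 IH2]; split => //.
by rewrite negbK => /IH1 ->; rewrite muln0.
Qed.

(** A mixed moment of independent standard normal variables. In polar coordinates it is the mean of
    x^m over the unit sphere, up to a factor depending only on [n] and the total degree. *)
Definition sphere_moment n (m : 'I_n -> nat) : nat :=
  (\prod_(i < n) normal_moment (m i))%N.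

Lemma sphere_moment_odd n (m : 'I_n -> nat) :
  odd (\sum_(i < n) m i) -> sphere_moment m = 0%N.
Proof.
move=> om; have [i mi] : exists i, odd (m i).
  apply/existsP; apply: contraLR om; rewrite negb_exists => /forallP em.
  rewrite (big_ind (fun k => ~~ odd k))// => a b ea eb.
  by rewrite oddD (negbTE ea).
by rewrite /sphere_moment (bigD1 i)//= normal_moment_odd.
Qed.

Section Pizzetti.
Context (n : nat) (R : realFieldType).
Implicit Types (p q u : mpoly n R) (c x : 'I_n -> R).

Local Notation Lap := (@laplacian n R).

Lemma laplacianD p q : laplacian (p + q) = laplacian p + laplacian q.
Proof. by rewrite -big_split; apply: eq_bigr => i _; rewrite !mderivD. Qed.

Lemma laplacianZ a p : laplacian (a *: p) = a *: laplacian p.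
Proof. by rewrite scaler_sumr; apply: eq_bigr => i _; rewrite !mderivZ. Qed.

Lemma laplacian0 : laplacian (0 : mpoly n R) = 0.
Proof. by rewrite /laplacian big1// => i _; rewrite !mderiv0. Qed.

Lemma iter_laplacian0 k : iter k Lap 0 = 0.
Proof. by elim: k => //= k ->; exact: laplacian0. Qed.

Lemma iter_laplacianD k p q :
  iter k Lap (p + q) = iter k Lap p + iter k Lap q.
Proof. by elim: k => //= k ->; exact: laplacianD. Qed.

Lemma iter_laplacianZ k a p :
  iter k Lap (a *: p) = a *: iter k Lap p.
Proof. by elim: k => //= k ->; exact: laplacianZ. Qed.

Lemma iter_laplacian_sum k I (r : seq I) (F : I -> mpoly n R) :
  iter k Lap (\sum_(i <- r) F i) =
  \sum_(i <- r) iter k Lap (F i).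
Proof. exact: (big_morph _ (iter_laplacianD k) (iter_laplacian0 k)). Qed.

Lemma laplacianX (m : multinom n) : laplacian (mpolyX R m) =
  \sum_i (m i * (m i).-1)%:R *:
    mpolyX R (mnm_sub (mnm_sub m (mnm1 i)) (mnm1 i)).
Proof.
apply: eq_bigr => i _; rewrite mderivX mderivZ mderivX scalerA -natrM.
by rewrite mnmBE mnm1E eqxx subn1.
Qed.

(** Differentiating twice in variable i yields m_i (m_i - 1), and the factor m_i - 1 is the one in
    the recursion of [normal_moment]. The remaining factors m_i add up to the degree 2(k+1), which
    turns 2^k k! into 2^(k+1) (k+1)!. *)
Lemma mcoeff0_iter_laplacianX k (m : multinom n) :
  mcoeff mnm0 (iter k Lap (mpolyX R m)) =
  if mdeg m == k.*2 then (2 ^ k * k`! * sphere_moment m)%:R else 0.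
Proof.
elim: k m => [|k IH] m.
  rewrite /= mcoeffX mdeg_eq0; case: eqP => // ->.
  by rewrite /sphere_moment big1// => i _; rewrite mnm0E.
rewrite iterSr laplacianX iter_laplacian_sum raddf_sum /=.
have E i : mcoeff mnm0 (iter k Lap ((m i * (m i).-1)%:R *:
     mpolyX R (mnm_sub (mnm_sub m (mnm1 i)) (mnm1 i)))) =
   if mdeg m == k.+1.*2 then (m i * (2 ^ k * k`! * sphere_moment m))%:R else 0.
  rewrite iter_laplacianZ mcoeffZ IH.
  (* If m_i is 0 or 1, the truncated exponents do not matter: the derivative has factor 0, and on
     the right either m_i or [normal_moment 1] is 0. *)
  have [mi|mi] := leqP (m i) 1.
    rewrite (_ : (m i * _)%N = 0%N) ?mul0r; last by case: (m i) mi => [|[|]].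
    case: ifP => // _; rewrite /sphere_moment (bigD1 i)//=.
    by case: (m i) mi => [|[|]]//= _; rewrite mul0n ?muln0.
  set m' := mnm_sub _ _.
  have mE : m = mnm_add (mnm_add m' (mnm1 i)) (mnm1 i).
    apply/mnmP => j; rewrite !mnmDE !mnmBE !mnm1E.
    by case: eqP => [<-|]; lia.
  have -> : mdeg m = (mdeg m').+2 by rewrite mE !mdegD !mdeg1 !addn1.
  rewrite doubleS !eqSS; case: eqP => [_|_]; last by rewrite mulr0.
  rewrite -natrM; congr (_%:R).
  rewrite /sphere_moment (bigD1 i)//= [in RHS](bigD1 i)//=.
  rewrite (_ : \prod_(j < n | j != i) normal_moment (m' j) =
     \prod_(j < n | j != i) normal_moment (m j))%N; last first.
    apply: eq_bigr => j ji; rewrite !mnmBE !mnm1E eq_sym (negbTE ji).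
    by rewrite !subn0.
  rewrite !mnmBE mnm1E eqxx; case: (m i) mi => [|[|a]]// _ /=.
  by rewrite !subn1 /=; ring.
under eq_bigr => i _ do rewrite E.
case: eqP => [md|_]; last by rewrite big1.
rewrite -natr_sum -big_distrl -mdegE md; congr (_%:R).
by rewrite expnS factS /=; lia.
Qed.

(** The polynomial p(x + c), whose coefficients are those of the expansion of [p] in powers of x -
    c. *)
Definition translate c p : mpoly n R :=
  comp_mpoly [tuple mpolyX R (mnm1 i) + mpolyC n (c i) | i < n] p.

Lemma meval_translate c x p :
  meval x (translate c p) = meval (fun i => x i + c i) p.
Proof.
rewrite comp_mpoly_meval; apply: meval_eq => i.
by rewrite tnth_mktuple mevalD mevalXU mevalC.
Qed.

(** By linearity and the Leibniz rule it suffices to treat single variables. *)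
Lemma mderiv_translate i c p :
  mderiv i (translate c p) = translate c (mderiv i p).
Proof.
pose P q := mderiv i (translate c q) = translate c (mderiv i q).
have PM q1 q2 : P q1 -> P q2 -> P (q1 * q2).
  rewrite /P /translate => P1 P2.
  by rewrite mderivM !rmorphM /= mderivM P1 P2 rmorphD /= !rmorphM.
have P1 : P 1.
  by rewrite /P /translate -mpolyC1 comp_mpolyC !mderivC comp_mpoly0.
elim/mpolyind : p => [|a m p mp c0 IH].
  by rewrite mderiv0 /translate comp_mpoly0 mderiv0.
rewrite mderivD /translate !comp_mpolyD mderivD -/(translate c p) IH.
congr (_ + _).
rewrite mderivZ !comp_mpolyZ mderivZ; congr (_ *: _).
rewrite mpolyXE_id; apply: (big_ind P) => // j _.
elim: (m j) => [|k IHk]; first by rewrite expr0.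
rewrite exprS; apply: PM IHk.
rewrite /P /translate comp_mpolyXU -tnth_nth tnth_mktuple.
rewrite mderivD mderivC addr0 mderivX mnm1E comp_mpolyZ.
case: eqP => [->|_]; last by rewrite !scale0r.
by rewrite -{1 3}[mnm1 i]add0m !addmK mpolyX0 comp_mpoly1.
Qed.

Lemma iter_laplacian_translate k c p :
  iter k Lap (translate c p) = translate c (iter k Lap p).
Proof.
elim: k => //= k ->; rewrite /laplacian /translate raddf_sum /=.
by apply: eq_bigr => i _; rewrite -!/(translate c _) !mderiv_translate.
Qed.

Lemma meval_translate_shift c x p : meval x p =
  \sum_(m <- msupp (translate c p))
    mcoeff m (translate c p) * \prod_(i < n) (x i - c i) ^+ m i.
Proof.
rewrite -mevalE meval_translate; apply: meval_eq => i; by rewrite subrK.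
Qed.

(* The moment of x^m over the unit ball of R^a is the volume of the ball times
   [radial_factor a |m| * sphere_moment m]; the value at odd |m| is irrelevant
   because [sphere_moment m] is then 0. *)
Fixpoint radial_factor (a k : nat) : R :=
  match k with
  | 0 | 1 => 1
  | k'.+2 => radial_factor a k' / (a + k'.+2)%:R
  end.

Lemma radial_factor_gt0 a k : 0 < radial_factor a k.
Proof.
suff H : 0 < radial_factor a k /\ 0 < radial_factor a k.+1 by case: H.
elim: k => [|k [IH1 IH2]]; first by rewrite /= !ltr01.
by split => //=; rewrite divr_gt0// ltr0n addnS.
Qed.

(** Explicitly 1 / (2^k k! (n+2)(n+4)...(n+2k)), the coefficient in Pizzetti's formula for means
    over balls. *)
Definition pizzetti_coef (k : nat) : R :=
  radial_factor n k.*2 / (2 ^ k * k`!)%:R.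

Lemma pizzetti_coef_gt0 k : 0 < pizzetti_coef k.
Proof.
by rewrite divr_gt0 ?radial_factor_gt0// ltr0n muln_gt0 expn_gt0 fact_gt0.
Qed.

(** Since |c| = r, the factor |c|^(2k) is r^(2k). The iterated Laplacians at [c] are those of the
    translate at 0, to which a monomial [m] contributes only when k is half its degree. *)
Lemma pizzetti_translate K (c : 'I_n -> R) p (r : R) :
  \sum_(i < n) c i ^+ 2 = r ^+ 2 -> (msize p <= K)%N ->
  meval c (pizzetti K pizzetti_coef p) =
  \sum_(m <- msupp (translate c p)) mcoeff m (translate c p) *
    (r ^+ mdeg m * radial_factor n (mdeg m) * (sphere_moment m)%:R).
Proof.
move=> cr pK; set q := translate c p.
pose F k := pizzetti_coef k * r ^+ k.*2 * mcoeff mnm0 (iter k Lap q).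
have FE k :
    meval c (pizzetti_coef k *: (normsq n R ^+ k * iter k Lap p)) = F k.
  rewrite mevalZ mevalM rmorphXn /= /F -mulrA; congr (_ * _).
  rewrite /q iter_laplacian_translate -meval0E meval_translate; congr (_ * _).
    rewrite -mul2n exprM -cr; congr (_ ^+ _).
    rewrite /normsq raddf_sum; apply: eq_bigr => i _.
    by rewrite /= expr2 mevalM mevalXU.
  by apply: meval_eq => i; rewrite add0r.
(* The range is extended by zero terms so that it visibly contains half the degree of every monomial
   of [q]. *)
have -> : meval c (pizzetti K pizzetti_coef p) =
    \sum_(0 <= k < K + msize q) F k.
  rewrite /pizzetti raddf_sum /= (big_cat_nat (n := K)) ?leq_addr//=.
  rewrite [X in _ = _ + X]big_nat_cond.
  rewrite [X in _ = _ + X]big1 ?addr0 => [|k]; last first.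
    rewrite andbT => /andP[Kk _]; rewrite -FE.
    have -> : iter k Lap p = 0.
      apply/eqP; rewrite -msize_poly_eq0 -leqn0.
      by rewrite (leq_trans (msize_iter_laplacian _ _))// leqn0 subn_eq0; lia.
    by rewrite mulr0 scaler0 meval0.
  by rewrite big_mkord; apply: eq_bigr => k _; exact: FE.
rewrite big_mkord.
have q_iter k : mcoeff mnm0 (iter k Lap q) = \sum_(m <- msupp q)
    mcoeff m q * mcoeff mnm0 (iter k Lap (mpolyX R m)).
  rewrite {1}[q]mpolyE iter_laplacian_sum raddf_sum /=.
  by apply: eq_bigr => m _; rewrite iter_laplacianZ mcoeffZ.
rewrite /F; under eq_bigr => k _ do rewrite q_iter mulr_sumr.
rewrite exchange_big /= big_seq [RHS]big_seq; apply: eq_bigr => m mq.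
have mK := msize_mdeg_lt mq.
(* For odd degree both sides are 0. *)
have [om|em] := boolP (odd (mdeg m)).
  rewrite sphere_moment_odd -?mdegE// !mulr0 big1// => k _.
  rewrite mcoeff0_iter_laplacianX ifN ?mulr0//.
  by apply: contraTneq om => ->; rewrite odd_double.
have lt_m : ((mdeg m)./2 < K + msize q)%N by lia.
have mE : mdeg m = (mdeg m)./2.*2 by lia.
rewrite (bigD1 (Ordinal lt_m))//= big1 ?addr0 => [|k km]; last first.
  rewrite mcoeff0_iter_laplacianX ifN ?mulr0//.
  by apply: contra km => /eqP mk; apply/eqP/val_inj; rewrite /= mk doubleK.
rewrite mcoeff0_iter_laplacianX -mE eqxx /pizzetti_coef -mE.
rewrite [in X in _ * (_ * X)]natrM.
by field; rewrite !pnatr_eq0 -!lt0n expn_gt0 fact_gt0.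
Qed.

End Pizzetti.

(** * Moments of balls *)

Section OneDim.
Context {R : realType}.
Local Notation mu := (@lebesgue_measure R).

(** The slice of the unit ball at height t is a ball of radius sqrt(1 - t^2). The exponent [s]
    stands for the dimension of the slice plus the degree in the remaining variables. *)
Definition chord a s (t : R) : R := t ^+ a * Num.sqrt (1 - t ^+ 2) ^+ s.

Definition chord_moment a s : R := \int[mu]_(t in `[-1, 1]) chord a s t.

Lemma continuous_chord a s : continuous (chord a s).
Proof.
move=> t; apply: cvgM; first exact: exprn_continuous.
apply: (@continuous_comp _ _ _ (fun t : R => Num.sqrt (1 - t ^+ 2))
  (fun y : R => y ^+ s)); last exact: exprn_continuous.
apply: (@continuous_comp _ _ _ (fun t : R => 1 - t ^+ 2) Num.sqrt).
  by apply: cvgB; [exact: cvg_cst|exact: exprn_continuous].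
exact: sqrt_continuous.
Qed.

Lemma integrable_continuous_itv (f : R -> R) a b : continuous f ->
  mu.-integrable `[a, b] (EFin \o f).
Proof.
move=> cf; apply: continuous_compact_integrable; first exact: segment_compact.
exact: continuous_subspaceT.
Qed.

(** The exponent [s.+2] absorbs the square root in the denominator of the derivative. For b = 0 the
    value of [b.-1] is immaterial, its term having factor 0. *)
Lemma is_derive_chord b s (t : R) : -1 < t < 1 ->
  is_derive t 1 (chord b s.+2)
    (b%:R * chord b.-1 s.+2 t - s.+2%:R * chord b.+1 s t).
Proof.
move=> t1.
have q0 : 0 < 1 - t ^+ 2 by nra.
have h0 : 0 < Num.sqrt (1 - t ^+ 2) by rewrite sqrtr_gt0.
have d1 := is_deriveB (is_derive_cst (1 : R) t 1)
  (is_deriveX 2 (is_derive_id t (1 : R))).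
pose g : R -> R := cst 1 - id ^+ 2.
have q1 : is_derive (g t) 1 Num.sqrt (2 * Num.sqrt (1 - t ^+ 2))^-1.
  exact: is_derive1_sqrt.
have d2 := @is_derive1_comp _ Num.sqrt g t _ _ q1 d1.
have d := is_deriveM (is_deriveX b (is_derive_id t 1)) (is_deriveX s.+2 d2).
apply: is_derive_eq.
  have -> : chord b s.+2 = id ^+ b * (Num.sqrt \o g) ^+ s.+2.
    apply/funext => y; rewrite /chord /=.
    by rewrite mulrfctE !exprfctE.
  exact: d.
rewrite !exprfctE /chord /= -/(g t).
have gE : g t = 1 - t ^+ 2 by [].
rewrite gE expr1 sub0r /GRing.scale /= !mulr1 (exprS _ s.+1) (exprS _ b).
move: h0; set h := Num.sqrt _ => h0.
rewrite exprS.
have h1 : h != 0 by rewrite gt_eqF.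
by field.
Qed.

(* [chord b s.+2] vanishes at both ends of [-1, 1], so its derivative has
   integral 0. *)
Lemma chord_moment_parts b s :
  b%:R * chord_moment b.-1 s.+2 = s.+2%:R * chord_moment b.+1 s.
Proof.
have I a s' : mu.-integrable `[-1, 1] (EFin \o (chord a s')).
  exact/integrable_continuous_itv/continuous_chord.
pose f (t : R) := b%:R * chord b.-1 s.+2 t - s.+2%:R * chord b.+1 s t.
have cZ (k : R) a s' : continuous (fun t => k * chord a s' t).
  by move=> t; apply: cvgM; [exact: cvg_cst|exact: continuous_chord].
have : \int[mu]_(t in `[-1, 1]) f t = 0.
  rewrite /Rintegral (@continuous_FTC2 _ f (chord b s.+2)).
  - by rewrite /chord sqrrN !expr1n subrr sqrtr0 expr0n /= !mulr0 subrr.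
  - by lra.
  - apply: continuous_subspaceT => t; apply: cvgB; exact: cZ.
  - split.
    + move=> t; rewrite in_itv /= => t1.
      by have [] := @is_derive_chord b s t t1.
    + apply: cvg_at_right_filter; exact: continuous_chord.
    + apply: cvg_at_left_filter; exact: continuous_chord.
  - move=> t; rewrite in_itv /= => t1; rewrite derive1E.
    by have [_] := @is_derive_chord b s t t1.
rewrite RintegralB//; last 2 first.
- exact/integrable_continuous_itv/cZ.
- exact/integrable_continuous_itv/cZ.
rewrite !RintegralZl// => /eqP; rewrite subr_eq0 => /eqP //.
Qed.

Lemma chord_momentSS a s :
  chord_moment a s.+2 = chord_moment a s - chord_moment a.+2 s.
Proof.
rewrite /chord_moment -RintegralB//; last 2 first.
- exact/integrable_continuous_itv/continuous_chord.
- exact/integrable_continuous_itv/continuous_chord.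
apply: eq_Rintegral => t; rewrite inE/= in_itv/= => t1.
have q0 : 0 <= 1 - t ^+ 2 by nra.
rewrite /chord (exprSr _ s.+1) (exprSr _ s) -[in LHS]mulrA -expr2 sqr_sqrtr//.
by rewrite (exprS _ a.+1) (exprS _ a); ring.
Qed.

Lemma chord_moment1 s : chord_moment 1 s = 0.
Proof.
have := chord_moment_parts 0 s; rewrite mul0r => /esym/eqP.
by rewrite mulf_eq0 pnatr_eq0 => /eqP.
Qed.

(** Integration by parts at [a.+1], with [chord_moment a s.+2] eliminated by [chord_momentSS]. *)
Lemma chord_moment_rec a s :
  (s + a + 3)%:R * chord_moment a.+2 s = a.+1%:R * chord_moment a s.
Proof.
have := chord_moment_parts a.+1 s; rewrite /= chord_momentSS => H.
have -> : (s + a + 3)%:R = s.+2%:R + a.+1%:R :> R.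
  by rewrite -natrD; congr (_%:R); lia.
by rewrite mulrDl -H; ring.
Qed.

Lemma chord_moment_recr a s :
  (s + a + 3)%:R * chord_moment a s.+2 = s.+2%:R * chord_moment a s.
Proof.
rewrite chord_momentSS mulrBr chord_moment_rec.
have -> : (s + a + 3)%:R = s.+2%:R + a.+1%:R :> R.
  by rewrite -natrD; congr (_%:R); lia.
ring.
Qed.

(** The one-dimensional identity behind the passage from dimension n to n+1. The case k = 0 follows
    from the recurrence in [a]; then [k] grows in steps of 2 by the recurrence in the exponent of
    the root. *)
Lemma radial_chord_moment n k a : ~~ odd k ->
  radial_factor R n k * chord_moment a (n + k) =
  radial_factor R n.+1 (k + a) * (normal_moment a)%:R * chord_moment 0 n.
Proof.
pose P a := chord_moment a n =
  radial_factor R n.+1 a * (normal_moment a)%:R * chord_moment 0 n.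
have base : P a.
  suff H : P a /\ P a.+1 by case: H.
  rewrite /P {P}.
  elim: a => [|a [IH1 IH2]].
    by split; rewrite /= ?chord_moment1 ?mulr0 ?mul0r ?mul1r // mul1r.
  split=> //.
  have D0 : (n + a + 3)%:R != 0 :> R by rewrite pnatr_eq0 addn3.
  apply: (mulfI D0); rewrite chord_moment_rec IH1 /=.
  have -> : (n.+1 + a.+2)%N = (n + a + 3)%N by lia.
  by rewrite natrM; field.
move=> ek; rewrite -[k](odd_double_half) (negbTE ek) add0n.
elim: (k./2) => [|{ek}k IH]; first by rewrite mul1r addn0 add0n.
rewrite doubleS !addnS addSn addSn /=.
have D0 : (n + k.*2 + a + 3)%:R != 0 :> R by rewrite pnatr_eq0 addn3.
have E0 : (n + k.*2.+2)%:R != 0 :> R by rewrite pnatr_eq0 !addnS.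
apply: (mulfI D0); rewrite mulrCA chord_moment_recr.
have -> : (n.+1 + (k.*2 + a).+2)%N = (n + k.*2 + a + 3)%N by lia.
transitivity (radial_factor R n k.*2 * chord_moment a (n + k.*2)).
  by rewrite -!addnS; field.
by rewrite IH; field.
Qed.

Lemma chord_moment_gt0 s : 0 < chord_moment 0 s.
Proof.
(* Even exponents: the recurrence starts from the length 2 of [-1, 1]. *)
have H k : 0 < chord_moment 0 k.*2.
  elim: k => [|k IH].
    rewrite /chord_moment (_ : chord 0 0 = cst 1); last first.
      by apply/funext => t; rewrite /chord !expr0 mulr1.
    rewrite Rintegral_cst// mul1r /= lebesgue_measure_itv /=.
    by rewrite lte_fin ifT /=; lra.
  have := chord_moment_recr 0 k.*2; rewrite addn0 -doubleS => H.
  rewrite -(pmulr_rgt0 _ (_ : 0 < (k.*2 + 3)%:R)) ?H ?mulr_gt0 ?ltr0n//.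
  by rewrite addn3.
(* As the square root is at most 1, the s-th power dominates the 2s-th. *)
apply: lt_le_trans (H s) _.
apply: le_Rintegral => //.
- exact/integrable_continuous_itv/continuous_chord.
- exact/integrable_continuous_itv/continuous_chord.
move=> t; rewrite /= in_itv /= => t1.
rewrite /chord !expr0 !mul1r -addnn exprD ler_piMr ?exprn_ge0 ?sqrtr_ge0//.
by rewrite exprn_ile1 ?sqrtr_ge0// -[leRHS]sqrtr1 ler_sqrt// gerBl sqr_ge0.
Qed.

Lemma continuous_slice (c r : R) a s : continuous (fun y : R =>
  (y - c) ^+ a * Num.sqrt (r ^+ 2 - (y - c) ^+ 2) ^+ s).
Proof.
move=> t; apply: cvgM.
  apply: (@continuous_comp _ _ _ (fun y : R => y - c) (fun y : R => y ^+ a)).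
    by apply: cvgB; [exact: cvg_id|exact: cvg_cst].
  exact: exprn_continuous.
apply: (@continuous_comp _ _ _ (fun y : R => Num.sqrt (r ^+ 2 - (y - c) ^+ 2))
  (fun y : R => y ^+ s)); last exact: exprn_continuous.
apply: (@continuous_comp _ _ _ (fun y : R => r ^+ 2 - (y - c) ^+ 2) Num.sqrt).
  apply: cvgB; first exact: cvg_cst.
  apply: (@continuous_comp _ _ _ (fun y : R => y - c) (fun y : R => y ^+ 2)).
    by apply: cvgB; [exact: cvg_id|exact: cvg_cst].
  exact: exprn_continuous.
exact: sqrt_continuous.
Qed.

(** Substitute y = c + r t: the power, the root and dy contribute r^a, r^s and r. *)
Lemma slice_moment (c r : R) a s : 0 < r ->
  (\int[mu]_(y in `[(c - r)%R, (c + r)%R])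
     ((y - c) ^+ a * Num.sqrt (r ^+ 2 - (y - c) ^+ 2) ^+ s)%:E)%E =
  (r ^+ (a + s).+1 * chord_moment a s)%:E.
Proof.
move=> r0.
pose F (t : R) := c + r * t.
have dF (t : R) : is_derive t 1 F r.
  have := is_deriveD (is_derive_cst c t 1) (is_deriveZ r (is_derive_id t 1)).
  by rewrite add0r scaler1.
have F' : derive1 F = cst r.
  by apply/funext => t; rewrite derive1E; have [] := dF t.
have cF : continuous F.
  move=> t; apply: cvgD; first exact: cvg_cst.
  apply: cvgM; [exact: cvg_cst|exact: cvg_id].
have -> : c - r = F (-1) by rewrite /F mulrN1.
have -> : c + r = F 1 by rewrite /F mulr1.
pose G (y : R) := (y - c) ^+ a * Num.sqrt (r ^+ 2 - (y - c) ^+ 2) ^+ s.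
rewrite (@integration_by_substitution_increasing _ F G).
- have ci : mu.-integrable `[-1, 1] (EFin \o chord a s).
    exact/integrable_continuous_itv/continuous_chord.
  rewrite /chord_moment /Rintegral EFinM fineK; last exact: integrable_fin_num.
  rewrite -integralZl//=.
  apply: eq_integral => t; rewrite inE/= in_itv/= => t1.
  rewrite -EFinM F' mulrfctE /G /F /chord /=; congr (_%:E).
  rewrite (_ : c + r * t - c = r * t); last by ring.
  rewrite !exprMn -[X in X - _]mulr1 -mulrBr sqrtrM ?sqr_ge0//.
  rewrite sqrtr_sqr gtr0_norm// exprMn [r ^+ (a + s).+1]exprS exprD.
  ring.
- lra.
- by move=> x y _ _ xy; rewrite ltrD2l ltr_pM2l.
- by rewrite F' => t _; exact: cst_continuous.
- by rewrite F'; exact: is_cvg_cst.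
- by rewrite F'; exact: is_cvg_cst.
- split.
  + by move=> t _; have [] := dF t.
  + by apply: cvg_at_right_filter; exact: cF.
  + by apply: cvg_at_left_filter; exact: cF.
- apply: continuous_subspaceT; exact: continuous_slice.
Qed.

End OneDim.

(** * Moments of balls in dimension n, by slicing along the first coordinate *)

Section Ball.
Context {R : realType}.
Local Notation mu := (@lebesgue_measure R).

(** Radius 0 is included because the extreme slices of a ball are points. *)
Lemma slice_moment_ge0 (c r : R) a s : 0 <= r ->
  (\int[mu]_(y in `[(c - r)%R, (c + r)%R])
     ((y - c) ^+ a * Num.sqrt (r ^+ 2 - (y - c) ^+ 2) ^+ s)%:E)%E =
  (r ^+ (a + s).+1 * chord_moment a s)%:E.
Proof.
rewrite le_eqVlt => /predU1P[<-|]; last exact: slice_moment.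
by rewrite subr0 addr0 set_itv1 integral_set1 expr0n mul0r.
Qed.

Definition shifted_monomial n (c : euclidean R n) (m : 'I_n -> nat)
    (x : euclidean R n) : R :=
  \prod_(i < n) (tnth x i - tnth c i) ^+ m i.

Lemma euclidean_ballE n (c x : euclidean R n) r : 0 <= r ->
  euclidean_ball c r x <-> \sum_(i < n) (tnth x i - tnth c i) ^+ 2 <= r ^+ 2.
Proof.
move=> r0; rewrite /euclidean_ball /=.
have s0 : 0 <= \sum_(i < n) (tnth x i - tnth c i) ^+ 2.
  by apply: sumr_ge0 => i _; exact: sqr_ge0.
by rewrite -{2}(sqr_sqrtr s0) ler_pXn2r ?nnegrE ?sqrtr_ge0.
Qed.

Lemma measurable_tnthB n (c : euclidean R n) i :
  measurable_fun [set: euclidean R n] (fun x => tnth x i - tnth c i).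
Proof.
apply: measurable_funB; [exact: (measurable_tnth i)|exact: measurable_cst].
Qed.

Lemma measurable_shifted_monomial n (c : euclidean R n) m :
  measurable_fun setT (shifted_monomial c m).
Proof.
apply: measurable_prod => i _; apply: measurable_funX; exact: measurable_tnthB.
Qed.

Lemma measurable_euclidean_ball n (c : euclidean R n) r :
  measurable (euclidean_ball c r).
Proof.
pose f (x : euclidean R n) : measurableTypeR R :=
  Num.sqrt (\sum_(i < n) (tnth x i - tnth c i) ^+ 2).
have mf : measurable_fun setT f.
  apply: (measurableT_comp (f := @Num.sqrt R)).
    by apply: continuous_measurable_fun; exact: sqrt_continuous.
  apply: measurable_sum => i; apply: measurable_funX; exact: measurable_tnthB.
have -> : euclidean_ball c r = setT `&` f @^-1` `]-oo, r].
  by rewrite setTI; apply/seteqP; split => x; rewrite /= in_itv.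
exact: mf.
Qed.

Lemma euclidean_ball_coord n (c x : euclidean R n) r i :
  euclidean_ball c r x -> `|tnth x i - tnth c i| <= r.
Proof.
apply: le_trans; rewrite -sqrtr_sqr ler_wsqrtr// (bigD1 i)//= lerDl.
by apply: sumr_ge0 => j _; exact: sqr_ge0.
Qed.

(** The ball lies in a box, whose measure is a product of finite lengths. *)
Lemma euclidean_ball_lty n (c : euclidean R n) r :
  (lebesgue_measure_tuple R n (euclidean_ball c r) < +oo)%E.
Proof.
pose A (i : 'I_n) : set (measurableTypeR R) :=
  `[tnth c i - r, tnth c i + r]%classic.
have mA i : measurable (A i) by exact: measurable_itv.
pose B := [set x : euclidean R n | forall i, A i (tnth x i)].
suff BE : (lebesgue_measure_tuple R n B < +oo)%E.
  apply: le_lt_trans BE.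
  apply: le_measure; rewrite ?inE.
  - exact: measurable_euclidean_ball.
  - rewrite (_ : B = \bigcap_(i in [set: 'I_n])
      ((fun x : euclidean R n => tnth x i) @^-1` A i)).
      apply: fin_bigcap_measurable; first exact: finite_finset.
      move=> i _; rewrite -[X in measurable X]setTI.
      exact: (measurable_tnth i).
    by apply/seteqP; split=> x /= Ax i; [move=> _|]; exact: Ax.
  - move=> x Bx i; have := euclidean_ball_coord i Bx.
    by rewrite /A /= in_itv /= ler_distl.
rewrite lebesgue_measure_tuple_box//.
suff /andP[] : (0 <= \prod_(i < n) mu (A i) < +oo)%E by [].
apply: (big_ind (fun x : \bar R => 0 <= x < +oo)%E).
- by rewrite lee01 ltry.
- move=> x y /andP[x0 xy] /andP[y0 yy].
  by rewrite mule_ge0//= lte_mul_pinfty// ge0_fin_numE.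
- move=> i _; rewrite measure_ge0 /A lebesgue_measure_itv /=; case: ifP => //.
  by move=> _; rewrite ltry.
Qed.

Lemma bounded_shifted_monomial n (c : euclidean R n) m r :
  [bounded shifted_monomial c m x | x in euclidean_ball c r].
Proof.
exists (\prod_(i < n) r ^+ m i); split; first exact: num_real.
move=> M rM x Bx; apply: le_trans (ltW rM).
rewrite normr_prod; apply: ler_prod => i _; rewrite normr_ge0/= normrX.
have xr := euclidean_ball_coord i Bx.
by apply: lerXn2r; rewrite ?nnegrE// (le_trans _ xr).
Qed.

Lemma integrable_shifted_monomial n (c : euclidean R n) m r :
  (lebesgue_measure_tuple R n).-integrable (euclidean_ball c r)
    (EFin \o shifted_monomial c m).
Proof.
apply: measurable_bounded_integrable.
- exact: measurable_euclidean_ball.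
- exact: euclidean_ball_lty.
- by apply: measurable_funTS; exact: measurable_shifted_monomial.
- exact: bounded_shifted_monomial.
Qed.

Fixpoint unit_ball_volume (n : nat) : R :=
  match n with
  | 0 => 1
  | n'.+1 => unit_ball_volume n' * chord_moment 0 n'
  end.

Lemma unit_ball_volume_gt0 n : 0 < unit_ball_volume n.
Proof.
by elim: n => [|n IH] /=; rewrite ?ltr01// mulr_gt0// chord_moment_gt0.
Qed.

Lemma cons_pair_tnth0 n (y : R) (x : euclidean R n) :
  tnth (cons_pair (y, x)) ord0 = y.
Proof. by []. Qed.

Lemma cons_pair_tnthS n (y : R) (x : euclidean R n) i :
  tnth (cons_pair (y, x)) (lift ord0 i) = tnth x i.
Proof. exact: tnthS. Qed.

(** The bound on |y - c0| is stated apart because [Num.sqrt] is 0 on negative numbers, and a ball of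
    radius 0 still contains its centre. *)
Lemma euclidean_ball_cons n (c0 y r : R) (c x : euclidean R n) : 0 <= r ->
  euclidean_ball (cons_pair (c0, c)) r (cons_pair (y, x)) <->
  `|y - c0| <= r /\
  euclidean_ball c (Num.sqrt (r ^+ 2 - (y - c0) ^+ 2)) x.
Proof.
move=> r0; rewrite euclidean_ballE// euclidean_ballE ?sqrtr_ge0//.
rewrite big_ord_recl !cons_pair_tnth0.
under eq_bigr do rewrite !cons_pair_tnthS.
set s := \sum_i _; have s0 : 0 <= s by apply: sumr_ge0 => i _; exact: sqr_ge0.
have E : (`|y - c0| <= r) = ((y - c0) ^+ 2 <= r ^+ 2).
  by rewrite -[(y - c0) ^+ 2]real_normK ?num_real// ler_pXn2r.
rewrite E; split=> [H|[H]].
  have H1 : (y - c0) ^+ 2 <= r ^+ 2 by apply: le_trans H; rewrite lerDl.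
  by split=> //; rewrite sqr_sqrtr ?subr_ge0// lerBrDl.
by rewrite sqr_sqrtr ?subr_ge0// lerBrDl.
Qed.

Lemma shifted_monomial_cons n (c0 y : R) (c x : euclidean R n) m :
  shifted_monomial (cons_pair (c0, c)) m (cons_pair (y, x)) =
  (y - c0) ^+ m ord0 * shifted_monomial c (fun i => m (lift ord0 i)) x.
Proof.
rewrite /shifted_monomial big_ord_recl !cons_pair_tnth0; congr (_ * _).
by apply: eq_bigr => i _; rewrite !cons_pair_tnthS.
Qed.

(** Fubini's theorem, transported along [cons_pair]. Boundedness on a set of finite measure provides
    the integrability, and extension by zero lets the slice depend on y. *)
Lemma integral_cons_measure n (B : set (euclidean R n.+1))
    (f : euclidean R n.+1 -> R) :
  measurable B -> measurable_fun setT f ->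
  (lebesgue_measure_tuple R n.+1 B < +oo)%E ->
  [bounded f x | x in B] ->
  (\int[lebesgue_measure_tuple R n.+1]_(x in B) (f x)%:E =
   \int[mu]_y \int[lebesgue_measure_tuple R n]_x
     ((EFin \o (f \o @cons_pair R n)) \_ (@cons_pair R n @^-1` B)) (y, x))%E.
Proof.
move=> mB mf Boo fB.
have mc := @measurable_cons_pair R n.
have mcB : measurable (@cons_pair R n @^-1` B).
  by rewrite -[X in measurable X]setTI; exact: mc.
have mfc : measurable_fun setT (f \o @cons_pair R n) by exact: measurableT_comp.
have intf : (mu \x lebesgue_measure_tuple R n)%E.-integrable
    (@cons_pair R n @^-1` B) (EFin \o (f \o @cons_pair R n)).
  apply: measurable_bounded_integrable => //.
    exact: measurable_funTS.
  case: fB => M [Mr HM]; exists M; split => // K MK z Bz.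
  exact: (HM K MK).
transitivity (
    \int[(mu \x lebesgue_measure_tuple R n)]_(x in @cons_pair R n @^-1` B)
      (EFin \o (f \o @cons_pair R n)) x)%E.
  rewrite /= /cons_measure.
  rewrite (@integral_pushforward _ _ _ _ R _ mc _ B (EFin \o f))//.
  exact/measurable_EFinP.
rewrite integral_mkcond -integral12_prod_meas1//.
by apply/(integrable_mkcond _ mcB).
Qed.

(** Induction on the dimension: the induction hypothesis integrates over a slice, [slice_moment_ge0]
    over its height, and [radial_chord_moment] matches the constants. *)
Lemma ball_moment n (c : euclidean R n) r m : 0 <= r ->
  (\int[lebesgue_measure_tuple R n]_(x in euclidean_ball c r)
     (shifted_monomial c m x)%:E)%E =
  (unit_ball_volume n * r ^+ (n + \sum_(i < n) m i) *
   radial_factor R n (\sum_(i < n) m i) * (sphere_moment m)%:R)%:E.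
Proof.
elim: n c r m => [|n IH] c r m r0.
  rewrite /= integral_dirac; first last.
  - apply/measurable_EFinP/measurable_funTS; exact: measurable_shifted_monomial.
  - exact: measurable_euclidean_ball.
  rewrite diracE mem_set; last by rewrite /euclidean_ball /= big_ord0 sqrtr0.
  rewrite /shifted_monomial /sphere_moment !big_ord0.
  by rewrite mul1e !mulr1.
have -> : c = cons_pair (uncons_tuple c) by rewrite uncons_tupleK.
case: (uncons_tuple c) => c0 {}c.
rewrite integral_cons_measure; last 4 first.
- exact: measurable_euclidean_ball.
- exact: measurable_shifted_monomial.
- exact: euclidean_ball_lty.
- exact: bounded_shifted_monomial.
pose m' i := m (lift ord0 i).
pose k := (\sum_(i < n) m' i)%N.
have mE : (\sum_(i < n.+1) m i = k + m ord0)%N by rewrite big_ord_recl addnC.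
have sE : sphere_moment m = (normal_moment (m ord0) * sphere_moment m')%N.
  by rewrite /sphere_moment big_ord_recl.
(* The part of the moment of a slice that does not depend on its radius. *)
pose C := unit_ball_volume n * radial_factor R n k * (sphere_moment m')%:R.
transitivity (\int[mu]_(y in `[(c0 - r)%R, (c0 + r)%R])
    (C%:E * ((y - c0) ^+ m ord0 *
             Num.sqrt (r ^+ 2 - (y - c0) ^+ 2) ^+ (n + k))%:E))%E.
  rewrite [RHS]integral_mkcond; apply: eq_integral => y _.
  rewrite patchE; case: ifPn => [yr|yr].
    have yr' : `|y - c0| <= r by move: yr; rewrite inE /= in_itv /= ler_distl.
    pose q := Num.sqrt (r ^+ 2 - (y - c0) ^+ 2).
    transitivity (\int[lebesgue_measure_tuple R n]_(x in euclidean_ball c q)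
        (((y - c0) ^+ m ord0)%:E * (shifted_monomial c m' x)%:E))%E.
      rewrite [RHS]integral_mkcond; apply: eq_integral => x _.
      rewrite !patchE; congr (if _ then _ else _).
        apply/idP/idP; rewrite !inE /= => H.
          by move/euclidean_ball_cons : H => /(_ r0) [].
        by apply/euclidean_ball_cons.
      by rewrite /= shifted_monomial_cons EFinM.
    rewrite integralZl//=; last 2 first.
    - exact: measurable_euclidean_ball.
    - exact: integrable_shifted_monomial.
    rewrite IH ?sqrtr_ge0// -!EFinM; congr (_%:E).
    by rewrite /C -/k -/q; ring.
  apply: integral0_eq => x _; rewrite patchE ifN//.
  apply: contra yr; rewrite !inE /= in_itv /= -ler_distl => H.
  by move/euclidean_ball_cons : H => /(_ r0) [].
rewrite integralZl//=; last first.
  exact/integrable_continuous_itv/continuous_slice.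
rewrite slice_moment_ge0// -EFinM; congr (_%:E).
rewrite mE sE natrM /C.
(* If [k] is odd, [sphere_moment m'] makes both sides 0; otherwise [radial_chord_moment] applies. *)
have [ok|ek] := boolP (odd k).
  by rewrite (sphere_moment_odd ok) !mulr0 mul0r.
have := radial_chord_moment n (m ord0) ek => H.
rewrite [r ^+ _ * _]mulrC !mulrA.
rewrite (_ : (n.+1 + (k + m ord0) = (m ord0 + (n + k)).+1)%N); last by lia.
transitivity (unit_ball_volume n * (sphere_moment m')%:R *
  r ^+ (m ord0 + (n + k)).+1 *
  (radial_factor R n k * chord_moment (m ord0) (n + k))); first by ring.
by rewrite H; ring.
Qed.

End Ball.

(** * Pizzetti's formula for integrals over balls, and the conclusion *)

Lemma integral_ball_pizzetti (R : realType) n K (p : mpoly n R)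
    (c : euclidean R n) (r : R) :
  0 <= r -> sphere n r c -> (msize p <= K)%N ->
  (\int[lebesgue_measure_tuple R n]_(x in euclidean_ball c r)
     (meval (tnth x) p)%:E)%E =
  (unit_ball_volume n * r ^+ n *
   meval (tnth c) (pizzetti K (@pizzetti_coef n R) p))%:E.
Proof.
move=> r0 cr pK; rewrite (pizzetti_translate cr)//.
set q := translate _ p.
(* The expansion of [p] in powers of x - c is integrated term by term, to match the sum given by
   [pizzetti_translate]. *)
transitivity (\int[lebesgue_measure_tuple R n]_(x in euclidean_ball c r)
    \sum_(m <- msupp q) ((mcoeff m q)%:E * (shifted_monomial c m x)%:E))%E.
  apply: eq_integral => x _; rewrite (meval_translate_shift (tnth c)) -sumEFin.
  by apply: eq_bigr => m _; rewrite EFinM.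
rewrite integral_sum//; last 2 first.
- exact: measurable_euclidean_ball.
- move=> m; apply: integrableZl; [exact: measurable_euclidean_ball|].
  exact: integrable_shifted_monomial.
rewrite mulr_sumr -sumEFin; apply: eq_bigr => m _.
rewrite integralZl//; last 2 first.
- exact: measurable_euclidean_ball.
- exact: integrable_shifted_monomial.
rewrite ball_moment// -EFinM -mdegE exprD; congr (_%:E).
ring.
Qed.

(** Carries the uniqueness in unisolvence from functions on the subtype of the sphere over to values
    of polynomials. *)
Lemma sphere_poly_vanish (R : realType) n d (r : R) (X : set (euclidean R n))
    (q : mpoly n R) :
  unisolvent d r X -> (msize q <= d.+1)%N ->
  (forall x, X x -> meval (tnth x) q = 0) ->
  forall x, sphere n r x -> meval (tnth x) q = 0.
Proof.
move=> [_ _ uni] qd q0 x xr.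
have := uni (fun x : sphere n r => meval (tnth (set_val x)) q).
move=> /(_ (ex_intro2 _ _ q qd erefl) (fun x => q0 (set_val x))).
by move=> /(congr1 (fun f => f (exist _ x (mem_set xr)))).
Qed.

Theorem theorem2p6 (R : realType) (n d : nat) (p : mpoly n R)
    (r : 'I_(d./2).+1 -> R) (Xi : set (euclidean R n)) :
  (1 <= n)%N ->
  (msize p <= d.+1)%N ->
  (forall j, 0 < r j) ->
  injective r ->
  (forall j : 'I_(d./2).+1,
    unisolvent (odd d + j.*2) (r j) (sphere n (r j) `&` Xi)) ->
  (forall (j : 'I_(d./2).+1) (xi : euclidean R n),
    (sphere n (r j) `&` Xi) xi ->
    (\int[lebesgue_measure_tuple R n]_(x in euclidean_ball xi (r j))
       (meval (tnth x) p)%:E)%E = 0%E) ->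
  p = 0.
Proof.
move=> n0 pd r0 rinj uni int0.
(* The operator gets [(msize p).+1] terms: at least one, as injectivity requires, and enough for
   Pizzetti's formula. *)
apply: (@pizzetti_inj _ _ (msize p) (@pizzetti_coef n R)).
  exact: pizzetti_coef_gt0.
set u := pizzetti _ _ _.
(* Indices become naturals through [inord], exact up to [d./2], and points become functions, as in
   [vanish_on_spheres_eq0]. *)
pose X j (x : 'I_n -> R) := (sphere n (r (inord j)) `&` Xi) [tuple x i | i < n].
have tupleE x q : meval x q = meval (tnth [tuple x i | i < n]) q.
  by apply: meval_eq => i; rewrite tnth_mktuple.
have sphereE x s :
    sphere n s [tuple x i | i < n] <-> \sum_(i < n) x i ^+ 2 = s ^+ 2.
  by rewrite /sphere /=; under eq_bigr do rewrite tnth_mktuple.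
apply: (@vanish_on_spheres_eq0 n R d./2 (odd d) (r \o inord) X) => //.
- by case: odd.
- by move=> j _; exact: r0.
- by move=> i j id jd /rinj /(congr1 val); rewrite /= !inordK.
- by move=> j x _ [/sphereE].
- move=> j q jd qd q0 x /sphereE xr; rewrite tupleE.
  have := uni (inord j); rewrite inordK// => /sphere_poly_vanish; apply => //.
  move=> y [yr yXi]; have yE : [tuple tnth y i | i < n] = y.
    by apply: eq_from_tnth => i; rewrite tnth_mktuple.
  by apply: q0; rewrite /X yE.
- by rewrite odd_double_half; apply: leq_trans pd; exact: msize_pizzetti.
- move=> j x jd [xr xXi]; rewrite tupleE; apply/eqP.
  (* The centre lies on the sphere of the same radius, so the integral is the value of [u] there
     times the unit ball volume and r_j^n, both nonzero. *)
  have := int0 (inord j) _ (conj xr xXi).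
  rewrite (@integral_ball_pizzetti _ _ (msize p).+1)// ?ltW//.
  move=> [] /eqP; rewrite !mulf_eq0 gt_eqF ?unit_ball_volume_gt0//=.
  by rewrite expf_eq0 gt_eqF ?andbF.
Qed.
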